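(* Let $G_S$ be a pseudo-connected self-loop graph with $|S|\ge1$, let $\widetilde G$ be its Açıkmeşe lift, and let $\lambda_{\min}$ be the smallest eigenvalue of $\mathcal{L}(G_S)$. Then $$-\frac1{\lambda_{\min}}<\mathcal{I}_{eq}(\widetilde G)<0.$$
   Context: Let $G$ be a finite undirected simple graph with vertex set $V=\{1,\dots,N\}$, and $S\subseteq V$. The self-loop graph $G_S$ is obtained from $G$ by attaching one loop at every vertex of $S$. $G_S$ is pseudo-connected if every connected component contains at least one looped vertex. The loop vector $s\in\mathbb{R}^N$ is the indicator vector of $S$. $\mathcal{L}(G)=D(G)-A(G)$ is the ordinary Laplacian and $\mathcal{L}(G_S):=\mathcal{L}(G)+\mathrm{diag}(s)$; it is positive definite when $G_S$ is pseudo-connected. For $|S|\ge1$, the Açıkmeşe lift $\widetilde G=(\widetilde V,\widetilde E)$ of $G_S$ is the simple graph on $\widetilde V=\{1,\dots,2N+1\}$ such that: for each edge $\{i,j\}$ of $G$, both $\{i,j\}$ and $\{i+N+1,j+N+1\}$ are edges of $\widetilde G$; for each $i\in S$, both $\{i,N+1\}$ and $\{N+1,i+N+1\}$ are edges; there are no other edges. $\mathcal{L}(\widetilde G)$ is the ordinary Laplacian of $\widetilde G$. The involution matrix $T$ is the $(2N+1)\times(2N+1)$ permutation matrix of the map swapping $i\leftrightarrow i+N+1$ ($1\le i\le N$) and fixing $N+1$. For the nontrivial element $g$ of $\mathbb{Z}_2$, $\chi_t^{\widetilde G}(g)=\mathrm{Tr}(e^{-t\mathcal{L}(\widetilde G)}T)$,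 $t>0$. The regularized equivariant heat integral is $\mathcal{I}_{eq}(\widetilde G)=\int_0^\infty(\chi_t^{\widetilde G}(g)-1)\,dt$. *)

(* Defs.v *)
From HB Require Import structures.
From mathcomp Require Import all_boot all_order all_algebra perm.
From mathcomp Require Import all_classical all_reals all_analysis.

Set Implicit Arguments.
Unset Strict Implicit.
Unset Printing Implicit Defensive.

Import Order.TTheory GRing.Theory Num.Theory.
Import numFieldNormedType.Exports.

Local Open Scope ring_scope.

(* Finite simple graphs on the vertex set {0, ..., n-1}. *)
Record sgraph (n : nat) := SGraph {
  adj :> rel 'I_n;
  adj_sym : symmetric adj;
  adj_irr : irreflexive adj }.

(* A self-loop graph G_S is given by the simple graph G and the set S of its
   looped vertices. *)
Definition pseudo_connected (N : nat) (G : sgraph N) (S : {set 'I_N}) : Prop :=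
  forall i : 'I_N, exists2 j : 'I_N, j \in S & connect G i j.

Section Laplacians.
Variable R : realType.

Definition adjacency_mx (n : nat) (G : sgraph n) : 'M[R]_n :=
  \matrix_(i, j) (G i j)%:R.

Definition degree_mx (n : nat) (G : sgraph n) : 'M[R]_n :=
  diag_mx (\row_i #|[set j | G i j]|%:R).

Definition laplacian (n : nat) (G : sgraph n) : 'M[R]_n :=
  degree_mx G - adjacency_mx G.

Definition loop_vector (N : nat) (S : {set 'I_N}) : 'rV[R]_N :=
  \row_i (i \in S)%:R.

Definition loop_laplacian (N : nat) (G : sgraph N) (S : {set 'I_N}) : 'M[R]_N :=
  laplacian G + diag_mx (loop_vector S).

Definition smallest_eigenvalue (n : nat) (A : 'M[R]_n) (lam : R) : Prop :=
  eigenvalue A lam /\ forall mu : R, eigenvalue A mu -> lam <= mu.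

End Laplacians.

(* The 2N+1 vertices of the lift form 'I_(N + (1 + N)). Counting from 0, [lo i],
   [mid] and [hi i] have values i, N and N+1+i. *)
Section Lift.
Variable N : nat.

Definition lo (i : 'I_N) : 'I_(N + (1 + N)) := lshift (1 + N) i.
Definition mid : 'I_(N + (1 + N)) := rshift N (lshift N ord0).
Definition hi (i : 'I_N) : 'I_(N + (1 + N)) := rshift N (rshift 1 i).

(* Each edge of the lift, in one of its two orientations. *)
Definition lift_arc (G : sgraph N) (S : {set 'I_N}) : rel 'I_(N + (1 + N)) :=
  fun u v =>
    [exists i, exists j, G i j &&
      (((u == lo i) && (v == lo j)) || ((u == hi i) && (v == hi j)))]
    || [exists i in S,
      ((u == lo i) && (v == mid)) || ((u == mid) && (v == hi i))].

Definition lift_adj (G : sgraph N) (S : {set 'I_N}) : rel 'I_(N + (1 + N)) :=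
  fun u v => lift_arc G S u v || lift_arc G S v u.

Lemma lift_adj_sym (G : sgraph N) (S : {set 'I_N}) : symmetric (lift_adj G S).
Proof. by move=> u v; rewrite /lift_adj orbC. Qed.

Lemma lift_adj_irr (G : sgraph N) (S : {set 'I_N}) : irreflexive (lift_adj G S).
Proof.
move=> u; rewrite /lift_adj orbb; apply/negP => /orP[].
  move=> /existsP[i /existsP[j /andP[Gij]]] /orP[] /andP[/eqP-> /eqP].
    by move/lshift_inj => ij; rewrite ij adj_irr in Gij.
  by move/rshift_inj/rshift_inj => ij; rewrite ij adj_irr in Gij.
move=> /existsP[i /andP[_]] /orP[] /andP[/eqP-> /eqP] /(congr1 val) /= E.
  by have := ltn_ord i; rewrite E addn0 ltnn.
by move/eqP: E; rewrite eqn_add2l.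
Qed.

Definition acikmese_lift (G : sgraph N) (S : {set 'I_N}) :
    sgraph (N + (1 + N)) :=
  SGraph (lift_adj_sym G S) (lift_adj_irr G S).

Definition lift_swap_fun (u : 'I_(N + (1 + N))) : 'I_(N + (1 + N)) :=
  match fintype.split u with
  | inl i => hi i
  | inr w => match fintype.split w with
             | inl _ => mid
             | inr i => lo i
             end
  end.

Lemma lift_swap_funK : involutive lift_swap_fun.
Proof.
have slo i : fintype.split (lo i) = inl i by rewrite /lo (unsplitK (inl i)).
have shi w : fintype.split (rshift N w) = inr w :> 'I_N + 'I_(1 + N).
  by rewrite (unsplitK (inr w)).
have smid : fintype.split (lshift N ord0) = inl ord0 :> 'I_1 + 'I_N.
  by rewrite (unsplitK (inl ord0)).
have sup_ i : fintype.split (rshift 1 i) = inr i :> 'I_1 + 'I_N.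
  by rewrite (unsplitK (inr i)).
move=> u; rewrite {2}/lift_swap_fun; case: split_ordP => [i ->|w ->].
  by rewrite /lift_swap_fun /hi shi sup_.
case: split_ordP => [z ->|i ->].
  by rewrite /lift_swap_fun /mid shi smid (ord1 z).
by rewrite /lift_swap_fun slo.
Qed.

Definition lift_swap : 'S_(N + (1 + N)) := perm (inv_inj lift_swap_funK).

Definition involution_mx (R : realType) : 'M[R]_(N + (1 + N)) :=
  perm_mx lift_swap.

End Lift.

Local Open Scope classical_set_scope.

Definition expmx (R : realType) (n : nat) (A : 'M[R]_n) : 'M[R]_n :=
  limn (series (fun k : nat => (k`!%:R)^-1 *: A ^+ k)).

(* The equivariant heat character at the nontrivial element of Z_2. *)
Definition heat_character (R : realType) (N : nat) (G : sgraph N)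
    (S : {set 'I_N}) (t : R) : R :=
  \tr (expmx (- t *: laplacian R (acikmese_lift G S)) *m involution_mx N R).

(* Kept in \bar R, so that finite bounds on it also say that the integral
   converges absolutely (the library's integral is a difference of the integrals
   of the positive and negative parts). *)
Definition eq_heat_integral (R : realType) (N : nat) (G : sgraph N)
    (S : {set 'I_N}) : \bar R :=
  (\int[lebesgue_measure]_(t in `]0%R, +oo[) (heat_character G S t - 1)%:E)%E.

(* Main.v *)
Require Import Defs.
From mathcomp Require Import all_boot all_order all_algebra perm.
From mathcomp Require Import all_classical all_reals all_analysis.
From mathcomp Require Import measurable_realfun complex ring lra.
Local Open Scope ring_scope.

(** Let [L] be the Laplacian of the self-loop graph and [A] that of its lift, on
    [n = 2N + 1] vertices, and let [1] be the all-ones row. Both bounds follow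
    from the closed formula
      I_eq = - (2 / n) * (1 L^-1 1^T).

    Why the formula holds. The matrix [A] is symmetric and positive
    semidefinite, and its kernel is spanned by the constants. In an orthonormal
    eigenbasis, Tr(e^{-tA} T) is a combination of exponentials e^{-t d_k}: the
    zero eigenvalue contributes exactly 1, because the involution [T] fixes the
    constants, and integrating the others replaces e^{-t d_k} by 1 / d_k. Hence
    I_eq = Tr(A^+ T) with [A^+] the pseudo-inverse of [A]
    ([integral_heat_trace]). Now ground the middle vertex: since 1 L is the loop
    vector, the block diagonal matrix X = diag(L^-1, 0, L^-1) satisfies
    A X = I - e 1, where [e] is the unit column of the middle vertex, so that
    A^+ = (I - J) X (I - J) with J = 1^T 1 / n. As [X T] has zero diagonal and
    [T] fixes the constants, Tr(A^+ T) = - (1 X 1^T) / n, and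
    1 X 1^T = 2 (1 L^-1 1^T) ([heat_integral_lift]).

    Why the bounds follow. [L] is positive definite by pseudo-connectedness
    ([loop_laplacian_posdef]), so 0 < 1 L^-1 1^T <= N / lambda_min
    ([posdef_inverse_form]), and 2N / (2N + 1) < 1.

    Everything rests on the orthogonal diagonalization of real symmetric
    matrices ([real_spectral]). *)

Set Implicit Arguments.
Unset Strict Implicit.
Unset Printing Implicit Defensive.

Import Order.TTheory GRing.Theory Num.Theory.
Import numFieldNormedType.Exports.

Local Open Scope classical_set_scope.

(** * Dot products and the real spectral theorem *)

Definition dotr (R : pzRingType) n (u v : 'rV[R]_n) : R := (u *m v^T) 0 0.

Lemma dotrE (R : pzRingType) n (u v : 'rV[R]_n) :
  dotr u v = \sum_i u 0 i * v 0 i.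
Proof. by rewrite /dotr mxE; apply: eq_bigr => i _; rewrite mxE. Qed.

Lemma dotr_ge0 (R : realDomainType) n (u : 'rV[R]_n) : 0 <= dotr u u.
Proof. by rewrite dotrE sumr_ge0 // => i _; rewrite -expr2 sqr_ge0. Qed.

Lemma dotr_eq0 (R : realDomainType) n (u : 'rV[R]_n) :
  (dotr u u == 0) = (u == 0).
Proof.
apply/eqP/eqP => [|->]; last by rewrite /dotr mul0mx mxE.
rewrite dotrE => /eqP; rewrite psumr_eq0 => [/allP u0|i _]; last first.
  by rewrite -expr2 sqr_ge0.
apply/rowP => i; have /implyP/(_ isT) := u0 i (mem_index_enum _).
by rewrite -expr2 sqrf_eq0 mxE => /eqP.
Qed.

Lemma dotr_gt0 (R : realDomainType) n (u : 'rV[R]_n) :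
  (0 < dotr u u) = (u != 0).
Proof. by rewrite lt_def dotr_eq0 dotr_ge0 andbT. Qed.

Lemma dotr_mx_diag (R : comPzRingType) n (x e : 'rV[R]_n) :
  dotr (x *m diag_mx e) x = \sum_i e 0 i * x 0 i ^+ 2.
Proof.
rewrite dotrE; apply: eq_bigr => i _; rewrite mul_mx_diag mxE expr2; ring.
Qed.

Lemma dotrDl (R : pzRingType) n (x y z : 'rV[R]_n) :
  dotr (x + y) z = dotr x z + dotr y z.
Proof. by rewrite /dotr mulmxDl mxE. Qed.

(** Viewed over the complex numbers the matrix is Hermitian, hence unitarily
    diagonalizable with real eigenvalues; and having [a] as an eigenvalue does
    not depend on the field. *)
Lemma symmetric_eigenvalue (R : rcfType) (n : nat) (A : 'M[R]_n.+1) :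
  A^T = A -> exists a, eigenvalue A a.
Proof.
move=> Asym; pose AC := map_mx (real_complex R) A.
have AC_herm : AC \is hermsymmx.
  apply: (@realsym_hermsym R[i]); first last.
    by apply/mxOverP => i j; rewrite mxE; apply/complex_realP; exists (A i j).
  apply/is_hermitianmxP; rewrite expr0 scale1r map_mx_id // /AC map_trmx.
  by rewrite Asym.
have /mxOverP/(_ 0 0)/complex_realP[a a_def] :=
  hermitian_spectral_diag_real AC_herm.
exists a; rewrite -(eigenvalue_map (real_complex R)).
have /hermitian_normalmx/orthomx_spectralP AC_eq := AC_herm.
set P := spectralmx AC in AC_eq; set D := spectral_diag AC in AC_eq a_def.
have Pu : P \in unitmx by exact: spectral_unit.
apply/eigenvalueP; exists (row 0 P).
  rewrite -/AC -row_mul [in LHS]AC_eq !mulmxA mulmxV // mul1mx row_mul.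
  by rewrite row_diag_mx a_def -scalemxAl -rowE.
apply: contraTneq Pu => P0; rewrite -row_free_unit; apply/negP => Pfree.
have /row_freeP[Q] := Pfree => /(congr1 (row 0)); rewrite row_mul P0 mul0mx.
by move=> /rowP/(_ 0)/eqP; rewrite !mxE eqxx eq_sym oner_eq0.
Qed.

(** The reflection that exchanges the unit vector [v] and the first basis vector
    [e], namely x |-> x - 2 (x.w)/(w.w) w with w = v - e. *)
Lemma householder (R : realFieldType) n (v : 'rV[R]_n.+1) :
  dotr v v = 1 -> exists H : 'M[R]_n.+1, H *m H^T = 1%:M /\ row 0 H = v.
Proof.
move=> v1; pose e : 'rV[R]_n.+1 := delta_mx 0 0.
(* A sigma type rather than a [pose], lest rewriting unfold the difference. *)
have [w wE] : {w | w = v - e} by exists (v - e).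
have [w0|wn0] := eqVneq w 0.
  exists 1%:M; rewrite trmx1 mulmx1; split => //.
  by rewrite row1; apply/esym/eqP; rewrite -subr_eq0 -/e -wE w0.
have ww : w *m w^T = (dotr w w)%:M by exact: mx11_scalar.
have dn0 : dotr w w != 0 by rewrite dotr_eq0.
pose H := 1%:M - (2 / dotr w w) *: (w^T *m w); exists H.
have HT : H^T = H by rewrite /H linearB /= trmx1 linearZ /= trmx_mul trmxK.
split.
  have KK : w^T *m w *m (w^T *m w) = dotr w w *: (w^T *m w).
    by rewrite mulmxA -[w^T *m w *m w^T]mulmxA ww mul_mx_scalar -scalemxAl.
  rewrite HT /H; set c := 2 / _.
  have cc : c * c * dotr w w = c + c by rewrite /c; field.
  rewrite mulmxBl mul1mx mulmxBr mulmx1 -scalemxAl -scalemxAr KK !scalerA.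
  by rewrite cc scalerDl opprB addrK subrK.
have ew : dotr e w = v 0 0 - 1.
  rewrite wE dotrE (bigD1 0) //= big1 ?addr0 => [|i i0]; last first.
    by rewrite !mxE (negPf i0) andbF mul0r.
  by rewrite !mxE eqxx mul1r.
have dww : dotr w w = - 2 * dotr e w.
  have -> : dotr w w = dotr v v - 2 * v 0 0 + 1.
    rewrite wE !dotrE (bigD1 0) //= [in RHS](bigD1 0) //=.
    rewrite (eq_bigr (fun i => v 0 i * v 0 i)) => [|i i0]; last first.
      by rewrite !mxE eqxx (negPf i0) subr0.
    by rewrite !mxE eqxx /=; ring.
  by rewrite v1 ew; ring.
rewrite rowE -/e /H mulmxBr mulmx1 -scalemxAr mulmxA.
have -> : e *m w^T = (dotr e w)%:M by exact: mx11_scalar.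
rewrite mul_scalar_mx scalerA (_ : _ * _ = -1).
  by rewrite scaleN1r opprK wE addrC subrK.
move: dn0; rewrite dww => dn0; field.
by move: dn0; rewrite mulf_eq0 oppr_eq0 pnatr_eq0.
Qed.

(** Induction on the size: in an orthonormal basis whose first vector is an
    eigenvector, a symmetric matrix is block diagonal, with a symmetric lower
    block. *)
Theorem real_spectral (R : rcfType) n (A : 'M[R]_n) : A^T = A ->
  exists (P : 'M[R]_n) (d : 'rV[R]_n),
    P *m P^T = 1%:M /\ A = P^T *m diag_mx d *m P.
Proof.
elim: n A => [|n IHn] A Asym.
  by exists 0, 0; split; apply/matrixP => - [].
have [a /eigenvalueP[v0 v0A v0n0]] := symmetric_eigenvalue Asym.
have v0gt0 : 0 < dotr v0 v0 by rewrite dotr_gt0.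
pose v := (Num.sqrt (dotr v0 v0))^-1 *: v0.
have v1 : dotr v v = 1.
  rewrite /v /dotr linearZ /= -scalemxAl -scalemxAr scalerA mxE -/(dotr v0 v0).
  by rewrite -invfM -expr2 sqr_sqrtr ?dotr_ge0 // mulVf // gt_eqF.
have vA : v *m A = a *: v by rewrite /v -scalemxAl v0A !scalerA mulrC.
have [H [HH Hv]] := householder v1.
have HTH : H^T *m H = 1%:M by exact: mulmx1C.
have [B B_def] : {B : 'M[R]_(1 + n) | B = H *m A *m H^T}.
  by exists (H *m A *m H^T).
have Bsym : B^T = B by rewrite B_def !trmx_mul trmxK Asym mulmxA.
have B0 : row 0 B = a *: delta_mx 0 0.
  by rewrite B_def !row_mul Hv vA -scalemxAl -Hv -row_mul HH row1.
have BE : B = block_mx a%:M 0 0 (drsubmx B).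
  have ur : ursubmx B = 0.
    apply/matrixP => i j; rewrite !mxE.
    have /rowP/(_ (rshift 1 j)) := B0; rewrite !mxE => E.
    by rewrite -[RHS](mulr0 a) -E (ord1 i); congr (B _ _); apply: val_inj.
  rewrite -[LHS]submxK; congr block_mx => //.
    rewrite [LHS]mx11_scalar; congr (_%:M); rewrite !mxE.
    have /rowP/(_ 0) := B0; rewrite !mxE eqxx mulr1 => <-.
    by congr (B _ _); apply: val_inj.
  by rewrite -[LHS]trmxK trmx_dlsub Bsym ur trmx0.
have [|P' [d' [PP' DE]]] := IHn (drsubmx B); first by rewrite trmx_drsub Bsym.
pose Q : 'M[R]_(1 + n) := block_mx 1%:M 0 0 P'.
have QQ : Q *m Q^T = 1%:M.
  rewrite /Q tr_block_mx !trmx0 trmx1 mulmx_block.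
  by rewrite !(mulmx0,mul0mx,addr0,add0r,mulmx1) PP' -scalar_mx_block.
exists (Q *m H), (row_mx (a%:M : 'M[R]_1) d'); split.
  by rewrite trmx_mul mulmxA -[Q *m H *m _]mulmxA HH mulmx1.
have -> : A = H^T *m B *m H.
  by rewrite B_def !mulmxA HTH mul1mx -mulmxA HTH mulmx1.
rewrite trmx_mul !mulmxA; congr (_ *m _); rewrite -!mulmxA; congr (_ *m _).
pose D := block_mx (diag_mx (a%:M : 'M[R]_1)) 0 0 (diag_mx d').
transitivity (Q^T *m (D *m Q)).
  rewrite BE DE /D /Q tr_block_mx !trmx0 trmx1 !mulmx_block.
  rewrite !(mulmx0,mul0mx,addr0,add0r,mulmx1,mul1mx) mulmxA.
  suff -> : diag_mx (a%:M : 'M[R]_1) = a%:M by [].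
  by apply/matrixP => i j; rewrite !ord1 !mxE.
by rewrite /D -diag_mx_row.
Qed.

(** Conjugation by an orthogonal matrix turns products of matrices that are
    diagonal in the same eigenbasis into products of eigenvalues. *)
Lemma mulmx_conj_diag (R : comNzRingType) n (P : 'M[R]_n) (d e : 'rV[R]_n) :
  P *m P^T = 1%:M ->
  P^T *m diag_mx d *m P *m (P^T *m diag_mx e *m P)
    = P^T *m diag_mx (\row_k (d 0 k * e 0 k)) *m P.
Proof.
move=> PP; rewrite !mulmxA -[_ *m P *m P^T]mulmxA PP mulmx1.
by rewrite -[_ *m diag_mx _ *m diag_mx _]mulmxA mulmx_diag.
Qed.

Section spectral_consequences.
Variables (R : realFieldType) (n : nat) (A P : 'M[R]_n) (d : 'rV[R]_n).
Hypothesis PP : P *m P^T = 1%:M.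
Hypothesis AE : A = P^T *m diag_mx d *m P.

Lemma spectral_row k : row k P *m A = d 0 k *: row k P.
Proof.
rewrite -row_mul AE !mulmxA PP mul1mx row_mul row_diag_mx -scalemxAl.
by rewrite rowE.
Qed.

Lemma spectral_row_norm k : dotr (row k P) (row k P) = 1.
Proof.
have /matrixP/(_ k k) := PP; rewrite !mxE eqxx mulr1n => <-.
by rewrite dotrE; apply: eq_bigr => i _; rewrite !mxE.
Qed.

Lemma spectral_eigenvalue k : eigenvalue A (d 0 k).
Proof.
apply/eigenvalueP; exists (row k P); first exact: spectral_row.
by rewrite -dotr_eq0 spectral_row_norm oner_eq0.
Qed.

Lemma spectral_form k : dotr (row k P *m A) (row k P) = d 0 k.
Proof.
by rewrite spectral_row /dotr -scalemxAl mxE -/(dotr _ _) spectral_row_norm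
  mulr1.
Qed.
End spectral_consequences.

(** * Matrix exponentials and their integrals *)

(** A neighbourhood of a matrix contains a product of neighbourhoods of its
    finitely many entries. *)
Lemma cvg_mx (R : realType) m n (u : nat -> 'M[R]_(m, n)) (M : 'M[R]_(m, n)) :
  (forall i j, (u k i j) @[k --> \oo] --> M i j) -> u @ \oo --> M.
Proof.
move=> uM A [B MB sBA].
have : \forall k \near \oo, forall i j, B i j (u k i j).
  apply: filter_forall => i; apply: filter_forall => j.
  exact: (uM i j _ (MB i j)).
by apply: filterS => k /sBA.
Qed.

(** In the eigenbasis the exponential series is, entry by entry, a fixed linear
    combination of the scalar exponential series at the eigenvalues. *)
Lemma expmx_diag (R : realType) n (P : 'M[R]_n) (d : 'rV[R]_n) :
  P *m P^T = 1%:M ->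
  expmx (P^T *m diag_mx d *m P) = P^T *m diag_mx (map_mx expR d) *m P.
Proof.
move=> PP.
have powE k : (P^T *m diag_mx d *m P) ^+ k
    = P^T *m diag_mx (map_mx (fun x => x ^+ k) d) *m P.
  elim: k => [|k IHk].
    rewrite expr0 (_ : map_mx _ d = const_mx 1) ?diag_const_mx ?mulmx1.
      by rewrite (mulmx1C PP).
    by apply/rowP => j; rewrite !mxE.
  rewrite exprSr IHk -[_ * _]/(_ *m _) mulmx_conj_diag //.
  congr (_ *m diag_mx _ *m _).
  by apply/rowP => j; rewrite !mxE -exprSr.
have entryE (e : 'rV[R]_n) i j : (P^T *m diag_mx e *m P) i j
   = \sum_k P k i * P k j * e 0 k.
  rewrite mxE; apply: eq_bigr => k _; rewrite mul_mx_diag !mxE.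
  by rewrite mulrAC.
apply/cvg_lim; first exact: norm_hausdorff.
apply: cvg_mx => i j; rewrite entryE.
have -> : (fun m =>
    series (fun l => l`!%:R^-1 *: (P^T *m diag_mx d *m P) ^+ l) m i j)
   = (fun m => \sum_k P k i * P k j * series (exp_coeff (d 0 k)) m).
  apply/funext => m; rewrite /series /= summxE.
  rewrite (eq_bigr (fun l => \sum_k l`!%:R^-1 * (P k i * P k j * d 0 k ^+ l)));
    last first.
    move=> l _; rewrite mxE powE entryE mulr_sumr.
    by apply: eq_bigr => k _; rewrite mxE.
  rewrite exchange_big /=; apply: eq_bigr => k _.
  rewrite mulr_sumr; apply: eq_bigr => l _; rewrite /exp_coeff /=; ring.
apply: cvg_big => [|k _]; first exact: add_continuous.
rewrite mxE; apply: cvgMl_tmp; exact: is_cvg_series_exp_coeff.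
Qed.

(** The integrand is, up to the factor [d^-1], the density of the exponential
    distribution of rate [d], whose total mass is 1. *)
Section exponential_integral.
Variables (R : realType) (d : R).
Hypothesis d_gt0 : 0 < d.
Local Notation D := (`]0%R, +oo[ : set R).

Let pdfE t : t \in D ->
  (expR (- t * d))%:E = ((d^-1)%:E * (exponential_pdf d t)%:E)%E.
Proof.
rewrite inE /= in_itv /= andbT => t0; rewrite exponential_pdfE ?ltW //.
by rewrite -EFinM mulrA mulVf ?gt_eqF // mul1r mulNr mulrC -mulNr.
Qed.

Lemma integrable_expRN :
  lebesgue_measure.-integrable D (fun t => (expR (- t * d))%:E).
Proof.
refine (@eq_integrable _ _ R lebesgue_measure D _
  (fun t => ((d^-1)%:E * (exponential_pdf d t)%:E)%E) _ _ _) => //.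
  by move=> t /pdfE.
apply: integrableZl => //.
by apply: integrableS (integrable_exponential_pdf d_gt0).
Qed.

Lemma integral_expRN :
  (\int[lebesgue_measure]_(t in D) (expR (- t * d))%:E = (d^-1)%:E)%E.
Proof.
under eq_integral => t tD do rewrite (pdfE tD).
rewrite integralZl //; last first.
  by apply: integrableS (integrable_exponential_pdf d_gt0).
rewrite integral_itv_obnd_cbnd; last first.
  by apply/measurable_EFinP; apply: measurable_funTS;
    exact: measurable_exponential_pdf.
rewrite [X in (_ * X)%E](_ : _ = 1%E) ?mule1 //.
rewrite -(integral_exponential_pdf d_gt0) [LHS]integral_mkcond.
apply: eq_integral => x _; rewrite patchE; case: ifPn => //.
rewrite notin_setE /= in_itv /= andbT => /negP; rewrite -ltNge => x0.
by rewrite lt0_exponential_pdf.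
Qed.

End exponential_integral.

Lemma integral_expRN_sum (R : realType) (n : nat) (c d : 'I_n -> R)
    (P : pred 'I_n) :
  (forall k, P k -> 0 < d k) ->
  (\int[lebesgue_measure]_(t in `]0%R, +oo[)
     (\sum_(k | P k) c k * expR (- t * d k))%:E
   = (\sum_(k | P k) c k / d k)%:E)%E.
Proof.
move=> d_gt0.
(* Interchanging sum and integral requires integrability for every index, hence
   the value 0 outside [P]. *)
pose f k (t : R) : \bar R :=
  if P k then ((c k)%:E * (expR (- t * d k))%:E)%E else 0%E.
have fE t :
    (\sum_(k | P k) c k * expR (- t * d k))%:E = (\sum_(k | P k) f k t)%E.
  by rewrite -sumEFin; apply: eq_bigr => k Pk; rewrite /f Pk.
under eq_integral => t _ do rewrite fE.
rewrite integral_sum //=; last first.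
  move=> k; rewrite /f; case: (boolP (P k)) => [/d_gt0 dk|_];
    last exact: integrable0.
  by apply: integrableZl => //; exact: integrable_expRN.
rewrite -sumEFin; apply: eq_bigr => k Pk.
under eq_integral => t _ do rewrite /f Pk.
rewrite integralZl //; last exact/integrable_expRN/d_gt0.
by rewrite integral_expRN ?d_gt0.
Qed.

(** * Laplacians as quadratic forms *)

Section laplacian_theory.
Variables (R : realType) (n : nat) (G : sgraph n).

Lemma laplacianE i j :
  laplacian R G i j = (\sum_k (G i k)%:R) *+ (i == j) - (G i j)%:R.
Proof.
rewrite !mxE -sum1_card natr_sum; congr (_ *+ _ - _).
rewrite big_mkcond; apply: eq_bigr => k _.
by rewrite inE; case: (G i k).
Qed.

Lemma laplacian_sym : (laplacian R G)^T = laplacian R G.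
Proof.
apply/matrixP => i j; rewrite mxE !laplacianE adj_sym eq_sym.
by case: eqP => [->|_].
Qed.

Lemma laplacian_row_sum : const_mx 1 *m laplacian R G = 0 :> 'rV_n.
Proof.
rewrite -laplacian_sym; apply/rowP => i; rewrite mxE [RHS]mxE.
under eq_bigr => j _ do rewrite mxE mul1r mxE laplacianE.
rewrite sumrB (bigD1 i) //= eqxx mulr1n [X in _ + X - _]big1 ?addr0 ?subrr //.
by move=> j /negPf; rewrite eq_sym => ->.
Qed.

(** Summing over ordered pairs counts every edge twice, whence the factor 2. *)
Lemma laplacian_form (x : 'rV[R]_n) :
  2 * dotr (x *m laplacian R G) x
    = \sum_i \sum_j (G i j)%:R * (x 0 i - x 0 j) ^+ 2.
Proof.
have E : dotr (x *m laplacian R G) x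
    = \sum_i \sum_j (G i j)%:R * (x 0 i ^+ 2 - x 0 i * x 0 j).
  rewrite -[laplacian R G]laplacian_sym dotrE; apply: eq_bigr => i _.
  rewrite mxE mulr_suml.
  under eq_bigr => j _ do rewrite mxE laplacianE.
  rewrite (eq_bigr (fun j => (\sum_k (G i k)%:R * x 0 i ^+ 2) *+ (i == j)
     - (G i j)%:R * (x 0 i * x 0 j))); last first.
    move=> j _; case: eqP => [<-|_]; rewrite ?mulr1n ?mulr0n; last by ring.
    by rewrite -mulr_suml expr2; ring.
  rewrite sumrB (bigD1 i) //= eqxx mulr1n [X in _ + X - _]big1 ?addr0;
    last first.
    by move=> j /negPf; rewrite eq_sym => ->.
  by rewrite -sumrB; apply: eq_bigr => j _; ring.
(* The same sum with the two ends of each edge exchanged. *)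
have E' : dotr (x *m laplacian R G) x
    = \sum_i \sum_j (G i j)%:R * (x 0 j ^+ 2 - x 0 i * x 0 j).
  rewrite E exchange_big; apply: eq_bigr => i _; apply: eq_bigr => j _.
  by rewrite adj_sym [x 0 i * _]mulrC.
rewrite mulr2n mulrDl !mul1r {1}E E' -big_split; apply: eq_bigr => i _.
rewrite -big_split; apply: eq_bigr => j _ /=; ring.
Qed.

Lemma laplacian_psd (x : 'rV[R]_n) : 0 <= dotr (x *m laplacian R G) x.
Proof.
rewrite -(pmulr_rge0 _ (ltr0n _ 2)) laplacian_form.
by apply: sumr_ge0 => i _; apply: sumr_ge0 => j _; rewrite mulr_ge0 ?sqr_ge0.
Qed.

(** The form is a sum of squares over the edges, so it vanishes only on
    functions that are constant along edges. *)
Lemma laplacian_form_eq0 (x : 'rV[R]_n) : dotr (x *m laplacian R G) x = 0 ->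
  forall i j, connect G i j -> x 0 i = x 0 j.
Proof.
move=> x0; have /eqP : \sum_i \sum_j (G i j)%:R * (x 0 i - x 0 j) ^+ 2 = 0.
  by rewrite -laplacian_form x0 mulr0.
rewrite psumr_eq0 => [/allP Gx|i _]; last first.
  by apply: sumr_ge0 => j _; rewrite mulr_ge0 ?sqr_ge0.
have Geq i j : G i j -> x 0 i = x 0 j.
  move=> Gij; have := Gx i (mem_index_enum _).
  rewrite implyTb psumr_eq0 => [/allP/(_ j (mem_index_enum _))|k _]; last first.
    by rewrite mulr_ge0 ?sqr_ge0.
  by rewrite implyTb Gij mul1r sqrf_eq0 subr_eq0 => /eqP.
move=> i j /connectP[p]; elim: p i => [i _ -> //|k p IHp i /= /andP[Gik Gp] jE].
by rewrite (Geq _ _ Gik); exact: IHp.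
Qed.
End laplacian_theory.

Section loop_laplacian_theory.
Variables (R : realType) (N : nat) (G : sgraph N) (S : {set 'I_N}).
Local Notation L := (loop_laplacian R G S).

Lemma loop_laplacianE i j :
  L i j = (\sum_k (G i k)%:R + (i \in S)%:R) *+ (i == j) - (G i j)%:R.
Proof.
rewrite mxE laplacianE !mxE.
by case: eqP => [->|_]; rewrite ?mulr1n ?mulr0n ?addr0 // addrAC.
Qed.

Lemma loop_laplacian_sym : L^T = L.
Proof. by rewrite /loop_laplacian linearD /= laplacian_sym tr_diag_mx. Qed.

Lemma loop_laplacian_row_sum : const_mx 1 *m L = loop_vector R S :> 'rV_N.
Proof.
rewrite mulmxDr laplacian_row_sum add0r.
by apply/rowP => i; rewrite mul_mx_diag mxE mxE mul1r.
Qed.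

(** A null vector is constant on connected components and zero at the looped
    vertices, and every component has such a vertex. *)
Lemma loop_laplacian_posdef (x : 'rV[R]_N) :
  pseudo_connected G S -> x != 0 -> 0 < dotr (x *m L) x.
Proof.
move=> hconn; apply: contraNT; rewrite -leNgt mulmxDr dotrDl dotr_mx_diag.
move=> le0.
have loop_ge0 i : 0 <= loop_vector R S 0 i * x 0 i ^+ 2.
  by rewrite mxE mulr_ge0 ?sqr_ge0.
have lap_ge0 := laplacian_psd G x.
have sum_ge0 : 0 <= \sum_i loop_vector R S 0 i * x 0 i ^+ 2 by exact: sumr_ge0.
have lap0 : dotr (x *m laplacian R G) x = 0 by lra.
have /eqP : \sum_i loop_vector R S 0 i * x 0 i ^+ 2 = 0 by lra.
rewrite psumr_eq0 // => /allP loop0.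
apply/eqP/rowP => i; have [j jS Gij] := hconn i.
rewrite (laplacian_form_eq0 lap0 Gij) mxE.
have := loop0 j (mem_index_enum _).
by rewrite implyTb mxE jS mul1r sqrf_eq0 => /eqP.
Qed.
End loop_laplacian_theory.

(** * Integrated heat traces *)

Section heat_trace.
Variables (R : realType) (n : nat).
Local Notation one := (const_mx 1 : 'rV[R]_n).

(** Read the hypothesis on [A *m X] column by column: each column of [X] solves
    the Poisson equation for a unit source at its vertex, balanced by the fixed
    sink [e]. This forces the kernel of [A] to consist of the constants, so the
    pseudo-inverse of [A] is [(1 - J) X (1 - J)] for [J] the projector onto the
    constants; the integral is the trace of its product with [M]. *)
Lemma integral_heat_trace (A X M : 'M[R]_n) (e : 'cV[R]_n) :
  (0 < n)%N ->
  A^T = A -> (forall x, 0 <= dotr (x *m A) x) ->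
  one *m A = 0 -> X^T = X -> A *m X = 1%:M - e *m one ->
  one *m M = one -> M *m one^T = one^T ->
  (\int[lebesgue_measure]_(t in `]0%R, +oo[)
     (\tr (expmx (- t *: A) *m M) - 1)%:E
    = (\tr (X *m M) - n%:R^-1 * dotr (one *m X) one)%:E)%E.
Proof.
move=> n0 Asym Apsd oneA Xsym AX oneM Mone.
have [P [d [PP AE]]] := real_spectral Asym.
have PTP : P^T *m P = 1%:M by exact: mulmx1C.
have d_ge0 k : 0 <= d 0 k by rewrite -(spectral_form PP AE) Apsd.
(* The inverse of 0 is 0, so this is the pseudo-inverse of [A]. *)
pose Ai := P^T *m diag_mx (map_mx GRing.inv d) *m P.
pose c k := (P *m M *m P^T) k k.
have trE (f : 'rV[R]_n) : \tr (P^T *m diag_mx f *m P *m M) = \sum_k c k * f 0 k.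
  rewrite -!mulmxA mxtrace_mulC -!mulmxA.
  by apply: eq_bigr => k _; rewrite mul_diag_mx mxE mulrC /c mulmxA.
(* The projector onto the kernel of [A]. *)
pose Q := 1%:M - A *m Ai.
have QE : Q = P^T *m diag_mx (\row_k (d 0 k == 0)%:R) *m P.
  have -> : Q = P^T *m diag_mx (const_mx 1) *m P - A *m Ai.
    by rewrite diag_const_mx mulmx1 PTP.
  rewrite AE mulmx_conj_diag // -mulmxBl -mulmxBr -linearB.
  congr (_ *m diag_mx _ *m _); apply/rowP => k; rewrite !mxE.
  by case: eqP => [->|/eqP dk]; rewrite ?mul0r ?subr0 // mulfV ?subrr.
have AAi : A *m Ai = Ai *m A.
  rewrite AE !mulmx_conj_diag //; congr (_ *m diag_mx _ *m _).
  by apply/rowP => k; rewrite !mxE mulrC.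
have AQ : A *m Q = 0.
  rewrite QE {1}AE mulmx_conj_diag // (_ : \row_k _ = 0).
    by rewrite linear0 mulmx0 mul0mx.
  by apply/rowP => k; rewrite !mxE; case: eqP => [->|_]; rewrite ?mul0r ?mulr0.
have QA : Q *m A = 0.
  by rewrite -AQ /Q mulmxBl mulmxBr mul1mx mulmx1 -mulmxA -AAi.
have XA : X *m A = 1%:M - one^T *m e^T.
  by rewrite -{1}Xsym -{1}Asym -trmx_mul AX linearB /= trmx1 trmx_mul.
have oo : one *m one^T = n%:R%:M.
  rewrite [LHS]mx11_scalar mxE; congr (_%:M).
  under eq_bigr => i _ do rewrite !mxE mulr1.
  by rewrite sumr_const card_ord.
have oneQ : one *m Q = one.
  by rewrite /Q mulmxBr mulmx1 mulmxA oneA mul0mx subr0.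
have Qe : Q = Q *m e *m one.
  apply/eqP; rewrite -subr_eq0.
  have -> : Q - Q *m e *m one = Q *m (1%:M - e *m one).
    by rewrite mulmxBr mulmx1 mulmxA.
  by rewrite -AX mulmxA QA mul0mx.
have eQ : Q = one^T *m (e^T *m Q).
  apply/eqP; rewrite -subr_eq0.
  have -> : Q - one^T *m (e^T *m Q) = (1%:M - one^T *m e^T) *m Q.
    by rewrite mulmxBl mul1mx mulmxA.
  by rewrite -XA -mulmxA AQ mulmx0.
pose J : 'M[R]_n := n%:R^-1 *: (one^T *m one).
have nn0 : n%:R != 0 :> R by rewrite pnatr_eq0 -lt0n.
have QJ : Q = J.
  have [z zE] : exists z, Q = z *: (one^T *m one).
    have Qz : Q = one^T *m (e^T *m Q *m e) *m one.
      by rewrite {1}Qe {1}eQ !mulmxA.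
    exists ((e^T *m Q *m e) 0 0).
    by rewrite {1}Qz [e^T *m Q *m e in LHS]mx11_scalar mul_mx_scalar -scalemxAl.
  rewrite zE /J; congr (_ *: _).
  have := oneQ; rewrite zE -scalemxAr mulmxA oo mul_scalar_mx scalerA.
  move=> /rowP/(_ (Ordinal n0)); rewrite !mxE mulr1 => zn.
  by rewrite -[z](mulfK nn0) zn mul1r.
have AiE : Ai = (1%:M - J) *m X *m (1%:M - J).
  have PiE : Ai *m A = 1%:M - J by rewrite -QJ -AAi /Q opprB addrC subrK.
  have -> : (1%:M - J) *m X = Ai - Ai *m e *m one.
    by rewrite -PiE -[Ai *m A *m X]mulmxA AX mulmxBr mulmx1 mulmxA.
  have oneJ : one *m (1%:M - J) = 0 by rewrite -QJ mulmxBr mulmx1 oneQ subrr.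
  rewrite mulmxBl -[Ai *m e *m one *m _]mulmxA oneJ mulmx0 subr0.
  rewrite -PiE /Ai AE !mulmx_conj_diag //; congr (_ *m diag_mx _ *m _).
  apply/rowP => k; rewrite !mxE; have [->|dk] := eqVneq (d 0 k) 0.
    by rewrite invr0 !mul0r.
  by rewrite mulVf // mulr1.
have tr_expE t : \tr (expmx (- t *: A) *m M) - 1
    = \sum_(k | d 0 k != 0) c k * expR (- t * d 0 k).
  have -> : - t *: A = P^T *m diag_mx (- t *: d) *m P.
    by rewrite AE linearZ /= -scalemxAr -scalemxAl.
  rewrite expmx_diag // trE (bigID (fun k => d 0 k == 0)) /=.
  have -> : \sum_(k | d 0 k == 0) c k * map_mx expR (- t *: d) 0 k = 1.
    transitivity (\tr (Q *m M)).
      rewrite QE trE big_mkcond; apply: eq_bigr => k _; rewrite !mxE.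
      by case: eqP => [->|_]; rewrite ?mulr0 ?expR0.
    rewrite QJ /J -scalemxAl linearZ /= -mulmxA oneM mxtrace_mulC oo.
    by rewrite mxtrace_scalar mulr1n mulVf.
  by rewrite addrAC subrr add0r; apply: eq_bigr => k _; rewrite !mxE.
under eq_integral => t _ do rewrite tr_expE.
rewrite integral_expRN_sum; last by move=> k dk; rewrite lt_def dk d_ge0.
congr (_%:E); transitivity (\tr (Ai *m M)).
  rewrite trE big_mkcond; apply: eq_bigr => k _; rewrite mxE.
  by case: eqP => [->|//]; rewrite invr0 mulr0.
rewrite AiE.
have JM : J *m M = J by rewrite /J -scalemxAl -mulmxA oneM.
have MJ : M *m J = J by rewrite /J -scalemxAr mulmxA Mone.
have JJ : J *m J = J by rewrite -{2}QJ /J -scalemxAl -mulmxA oneQ.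
have -> : \tr ((1%:M - J) *m X *m (1%:M - J) *m M)
    = \tr (X *m M) - \tr (X *m J).
  rewrite -2!mulmxA mxtrace_mulC -!mulmxA -linearB /= -mulmxBr;
    congr (\tr (_ *m _)).
  rewrite mulmxA mulmxBr mulmx1 mulmxBl mul1mx JM mulmxBl MJ JJ.
  by rewrite subrr subr0.
congr (_ - _); rewrite /J -scalemxAr linearZ /= mulmxA mxtrace_mulC mulmxA.
by rewrite /dotr {1}/mxtrace big_ord1.
Qed.
End heat_trace.

(** * The lift *)

Section lift.
Variables (R : realType) (N : nat) (G : sgraph N) (S : {set 'I_N}).
Local Notation "'1r'" := (const_mx 1 : 'rV[R]_N).
Local Notation L := (loop_laplacian R G S).
Local Notation s := (loop_vector R S).

Let lo_eq (i j : 'I_N) : (lo i == lo j) = (i == j).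
Proof. exact: (inj_eq (@lshift_inj _ _)). Qed.
Let hi_eq (i j : 'I_N) : (hi i == hi j) = (i == j).
Proof. by rewrite (inj_eq (@rshift_inj _ _)) (inj_eq (@rshift_inj _ _)). Qed.
Let lo_hi (i j : 'I_N) : (lo i == hi j) = false.
Proof. exact: eq_lrshift. Qed.
Let lo_mid (i : 'I_N) : (lo i == mid N) = false.
Proof. exact: eq_lrshift. Qed.
Let hi_mid (i : 'I_N) : (hi i == mid N) = false.
Proof. by rewrite (inj_eq (@rshift_inj _ _)) eq_rlshift. Qed.
Let hi_lo (i j : 'I_N) : (hi i == lo j) = false.
Proof. by rewrite eq_sym lo_hi. Qed.
Let mid_lo (i : 'I_N) : (mid N == lo i) = false.
Proof. by rewrite eq_sym lo_mid. Qed.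
Let mid_hi (i : 'I_N) : (mid N == hi i) = false.
Proof. by rewrite eq_sym hi_mid. Qed.
Let lift_eqE := (lo_eq, hi_eq, lo_hi, lo_mid, hi_mid, hi_lo, mid_lo, mid_hi,
  eqxx).

Let arc_lo_lo i j : lift_arc G S (lo i) (lo j) = G i j.
Proof.
apply/orP/idP => [[/existsP[k /existsP[l]]|/existsP[k]]|Gij]; rewrite ?lift_eqE.
- by rewrite orbF => /and3P[Gkl /eqP-> /eqP->].
- by rewrite ?andbF ?andbT.
- by left; apply/existsP; exists i; apply/existsP; exists j;
  rewrite !lift_eqE Gij.
Qed.
Let arc_hi_hi i j : lift_arc G S (hi i) (hi j) = G i j.
Proof.
apply/orP/idP => [[/existsP[k /existsP[l]]|/existsP[k]]|Gij]; rewrite ?lift_eqE.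
- by move=> /and3P[Gkl /eqP-> /eqP->].
- by rewrite ?andbF ?andbT.
- by left; apply/existsP; exists i; apply/existsP; exists j;
  rewrite !lift_eqE Gij.
Qed.
Let arc_lo_hi i j : lift_arc G S (lo i) (hi j) = false.
Proof.
by apply/orP => -[/existsP[k /existsP[l]]|/existsP[k]];
  rewrite !lift_eqE ?andbF.
Qed.
Let arc_hi_lo i j : lift_arc G S (hi i) (lo j) = false.
Proof.
by apply/orP => -[/existsP[k /existsP[l]]|/existsP[k]];
  rewrite !lift_eqE ?andbF.
Qed.
Let arc_lo_mid i : lift_arc G S (lo i) (mid N) = (i \in S).
Proof.
apply/orP/idP => [[/existsP[k /existsP[l]]|/existsP[k]]|iS];
  rewrite ?lift_eqE ?andbF //.
  by rewrite andbT orbF => /andP[kS /eqP->].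
by right; apply/existsP; exists i; rewrite !lift_eqE iS.
Qed.
Let arc_mid_hi i : lift_arc G S (mid N) (hi i) = (i \in S).
Proof.
apply/orP/idP => [[/existsP[k /existsP[l]]|/existsP[k]]|iS];
  rewrite ?lift_eqE ?andbF //.
  by move=> /andP[kS /eqP->].
by right; apply/existsP; exists i; rewrite !lift_eqE iS.
Qed.
Let arc_mid_lo i : lift_arc G S (mid N) (lo i) = false.
Proof.
by apply/orP => -[/existsP[k /existsP[l]]|/existsP[k]];
  rewrite !lift_eqE ?andbF.
Qed.
Let arc_hi_mid i : lift_arc G S (hi i) (mid N) = false.
Proof.
by apply/orP => -[/existsP[k /existsP[l]]|/existsP[k]];
  rewrite !lift_eqE ?andbF.
Qed.
Let arcE := (arc_lo_lo, arc_hi_hi, arc_lo_hi, arc_hi_lo, arc_lo_mid, arc_mid_hi,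
  arc_mid_lo, arc_hi_mid).

Local Notation GL := (acikmese_lift G S).

Let lift_lo_lo i j : GL (lo i) (lo j) = G i j.
Proof. by rewrite /= /lift_adj !arcE adj_sym orbb. Qed.
Let lift_hi_hi i j : GL (hi i) (hi j) = G i j.
Proof. by rewrite /= /lift_adj !arcE adj_sym orbb. Qed.
Let lift_lo_hi i j : GL (lo i) (hi j) = false.
Proof. by rewrite /= /lift_adj !arcE. Qed.
Let lift_hi_lo i j : GL (hi i) (lo j) = false.
Proof. by rewrite /= /lift_adj !arcE. Qed.
Let lift_lo_mid i : GL (lo i) (mid N) = (i \in S).
Proof. by rewrite /= /lift_adj !arcE orbF. Qed.
Let lift_hi_mid i : GL (hi i) (mid N) = (i \in S).
Proof. by rewrite /= /lift_adj !arcE. Qed.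
Let lift_mid_lo i : GL (mid N) (lo i) = (i \in S).
Proof. by rewrite adj_sym lift_lo_mid. Qed.
Let lift_mid_hi i : GL (mid N) (hi i) = (i \in S).
Proof. by rewrite adj_sym lift_hi_mid. Qed.

Let sum_lift (f : 'I_(N + (1 + N)) -> R) :
  \sum_u f u = \sum_i f (lo i) + (f (mid N) + \sum_i f (hi i)).
Proof. by rewrite big_split_ord /= big_split_ord /= big_ord1. Qed.

(** The blocks are indexed by the lower copy of the graph, the middle vertex and
    the upper copy. The diagonal entry [m] at the middle vertex stays implicit,
    since the matrix to be multiplied with this one vanishes there. *)
Lemma laplacian_lift : exists m : R, laplacian R GL =
  block_mx L (row_mx (- s^T) 0)
           (col_mx (- s) 0) (block_mx m%:M (- s) (- s^T) L).
Proof.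
exists (laplacian R GL (mid N) (mid N)).
pose blockE := (block_mxEul, block_mxEur, block_mxEdl, block_mxEdr,
  row_mxEl, row_mxEr, col_mxEu, col_mxEd).
have deg_lo i : \sum_k (GL (lo i) k)%:R = \sum_k (G i k)%:R + (i \in S)%:R :> R.
  rewrite sum_lift lift_lo_mid [X in _ + (_ + X)]big1 ?addr0 => [|j _].
    by congr (_ + _); apply: eq_bigr => j _; rewrite lift_lo_lo.
  by rewrite lift_lo_hi.
have deg_hi i : \sum_k (GL (hi i) k)%:R = \sum_k (G i k)%:R + (i \in S)%:R :> R.
  rewrite sum_lift lift_hi_mid big1 ?add0r => [|j _].
    by rewrite addrC; congr (_ + _); apply: eq_bigr => j _; rewrite lift_hi_hi.
  by rewrite lift_hi_lo.
have entry u v : u != v -> laplacian R GL u v = - (GL u v)%:R.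
  by move=> /negPf uv; rewrite laplacianE uv mulr0n sub0r.
apply/matrixP => u v.
case: (split_ordP u) => [i ->|w ->]; last case: (split_ordP w) => [z ->|i ->];
  rewrite ?(ord1 z) -?/(lo _) -?/(mid N) -?/(hi _);
  (case: (split_ordP v) => [j ->|w' ->];
    last case: (split_ordP w') => [z' ->|j ->];
  rewrite ?(ord1 z') !blockE -?/(lo _) -?/(mid N) -?/(hi _)).
- by rewrite loop_laplacianE laplacianE lift_lo_lo deg_lo lo_eq.
- by rewrite entry ?lift_eqE // lift_lo_mid !mxE.
- by rewrite entry ?lift_eqE // lift_lo_hi !mxE oppr0.
- by rewrite entry ?lift_eqE // lift_mid_lo !mxE.
- by rewrite [RHS]mxE eqxx mulr1n.
- by rewrite entry ?lift_eqE // lift_mid_hi !mxE.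
- by rewrite entry ?lift_eqE // lift_hi_lo !mxE oppr0.
- by rewrite entry ?lift_eqE // lift_hi_mid !mxE.
- by rewrite loop_laplacianE laplacianE lift_hi_hi deg_hi hi_eq.
Qed.

Lemma lift_swap_lo i : lift_swap N (lo i) = hi i.
Proof. by rewrite permE /lift_swap_fun (unsplitK (inl i)). Qed.

Lemma lift_swap_mid : lift_swap N (mid N) = mid N.
Proof.
by rewrite permE /lift_swap_fun /mid (unsplitK (inr _)) (unsplitK (inl ord0)).
Qed.

Lemma lift_swap_hi i : lift_swap N (hi i) = lo i.
Proof.
by rewrite permE /lift_swap_fun /hi (unsplitK (inr _)) (unsplitK (inr i)).
Qed.

(** The Green matrix grounded at the middle vertex is block diagonal, so its
    product with the involution, which exchanges the two copies, is traceless: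
    only the projection onto the constants contributes. *)
Lemma heat_integral_lift (Li : 'M[R]_N) : Li *m L = 1%:M -> Li^T = Li ->
  eq_heat_integral R G S
  = (- (2 / (N + (1 + N))%:R * dotr (1r *m Li) 1r))%:E.
Proof.
move=> LiL Lisym.
have LLi : L *m Li = 1%:M by exact: mulmx1C.
pose X : 'M[R]_(N + (1 + N)) := block_mx Li 0 0 (block_mx 0 0 0 Li).
pose e : 'cV[R]_(N + (1 + N)) := col_mx 0 (col_mx (1%:M : 'M[R]_1) 0).
have oneE : (const_mx 1 : 'rV[R]_(N + (1 + N))) = row_mx 1r (row_mx 1%:M 1r).
  rewrite -!row_mx_const; congr (row_mx _ (row_mx _ _)).
  by apply/rowP => i; rewrite !mxE ord1.
have sLi : s *m Li = 1r.
  by rewrite -(loop_laplacian_row_sum R G S) -mulmxA LLi mulmx1.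
have [m AE] := laplacian_lift.
have Xsym : X^T = X by rewrite /X !tr_block_mx !trmx0 Lisym.
have AX : laplacian R GL *m X = 1%:M - e *m const_mx 1.
  rewrite oneE AE /X /e mul_col_row mul0mx mul_col_row !mul0mx mul1mx.
  rewrite !mulmx_block !(mulmx0, mul0mx, addr0, add0r) LLi.
  rewrite mul_row_block mul_col_mx !(mulmx0, mul0mx, addr0, add0r) row_mx0.
  rewrite mulNmx sLi mul_col_mx mul0mx !mul1mx [in RHS]scalar_mx_block.
  rewrite [in RHS]scalar_mx_block !(opp_block_mx, add_block_mx) opp_col_mx.
  by rewrite !(subr0, oppr0, sub0r, addr0, add0r, subrr).
have oneT : const_mx 1 *m involution_mx N R = const_mx 1 :> 'rV_(N + (1 + N)).
  rewrite /involution_mx -[lift_swap N]invgK -col_permE.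
  by apply/rowP => i; rewrite !mxE.
have Tone :
    involution_mx N R *m (const_mx 1 : 'rV_(N + (1 + N)))^T = (const_mx 1)^T.
  by rewrite -row_permE; apply/colP => i; rewrite !mxE.
have trXT : \tr (X *m involution_mx N R) = 0.
  rewrite mxtrace_mulC -row_permE /mxtrace sum_lift.
  rewrite big1 ?add0r => [|i _]; last first.
    by rewrite mxE lift_swap_lo /hi /lo block_mxEdl mxE.
  rewrite mxE lift_swap_mid /mid block_mxEdr block_mxEul mxE add0r.
  rewrite big1 // => i _.
  by rewrite mxE lift_swap_hi /hi /lo block_mxEur mxE.
have oXo : dotr (const_mx 1 *m X) (const_mx 1) = 2 * dotr (1r *m Li) 1r.
  rewrite oneE /dotr /X mul_row_block mul_row_block !(mulmx0, addr0, add0r).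
  rewrite !tr_row_mx !mul_row_col mul0mx add0r mxE; ring.
have := integral_heat_trace _ (laplacian_sym R GL) (laplacian_psd GL)
  (laplacian_row_sum R GL) Xsym AX oneT Tone.
rewrite trXT oXo sub0r mulrA [_^-1 * 2]mulrC => <- //.
by rewrite addnCA.
Qed.
End lift.

(** * Inverses of positive definite matrices *)

Section inverse_form.
Variables (R : realType) (n : nat) (L : 'M[R]_n).
Hypothesis Lsym : L^T = L.
Hypothesis Lpos : forall x, x != 0 -> 0 < dotr (x *m L) x.

(** In an orthonormal eigenbasis the form of the inverse is a combination of
    the inverse eigenvalues, weighted by the squared coordinates of [u], and
    these weights sum to [dotr u u]. *)
Lemma posdef_inverse_form (lam : R) (u : 'rV[R]_n) :
  smallest_eigenvalue L lam -> u != 0 ->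
  exists Li, [/\ Li *m L = 1%:M, Li^T = Li, 0 < lam,
   0 < dotr (u *m Li) u & dotr (u *m Li) u <= dotr u u / lam].
Proof.
move=> [/eigenvalueP[v vL vn0] lam_min] un0.
have [P [d [PP LE]]] := real_spectral Lsym.
have PTP : P^T *m P = 1%:M by exact: mulmx1C.
have lam_gt0 : 0 < lam.
  have := Lpos vn0.
  by rewrite vL /dotr -scalemxAl mxE -/(dotr _ _) pmulr_lgt0 // dotr_gt0.
have lam_d k : lam <= d 0 k by exact/lam_min/(spectral_eigenvalue PP LE).
have d_gt0 k : 0 < d 0 k by exact: lt_le_trans (lam_d k).
pose Li := P^T *m diag_mx (map_mx GRing.inv d) *m P; exists Li.
pose y := u *m P^T.
have formE : dotr (u *m Li) u = \sum_k (d 0 k)^-1 * y 0 k ^+ 2.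
  have uE : u = y *m P by rewrite /y -mulmxA PTP mulmx1.
  have -> : dotr (u *m Li) u = dotr (y *m diag_mx (map_mx GRing.inv d)) y.
    rewrite /Li !mulmxA -/y [X in dotr _ X = _]uE /dotr trmx_mul !mulmxA.
    by rewrite -[_ *m P *m P^T]mulmxA PP mulmx1.
  rewrite dotr_mx_diag; apply: eq_bigr => k _.
  by rewrite mxE.
have normE : dotr u u = \sum_k y 0 k ^+ 2.
  transitivity (dotr y y).
    rewrite /dotr /y trmx_mul trmxK mulmxA -[_ *m P^T *m P]mulmxA PTP.
    by rewrite mulmx1.
  by rewrite dotrE; apply: eq_bigr => k _; rewrite expr2.
split => //.
- rewrite LE /Li mulmx_conj_diag // (_ : \row_k _ = const_mx 1).
    by rewrite diag_const_mx mulmx1.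
  by apply/rowP => k; rewrite !mxE mulVf // gt_eqF.
- by rewrite /Li !trmx_mul trmxK tr_diag_mx mulmxA.
- rewrite lt_def formE sumr_ge0 ?andbT; last first.
    by move=> k _; rewrite mulr_ge0 ?sqr_ge0 // invr_ge0 ltW.
  apply: contra un0; rewrite psumr_eq0 => [/allP y0|k _]; last first.
    by rewrite mulr_ge0 ?sqr_ge0 // invr_ge0 ltW.
  rewrite -dotr_eq0 normE big1 // => k _; have := y0 k (mem_index_enum _).
  by rewrite implyTb mulf_eq0 invr_eq0 gt_eqF //= => /eqP.
- rewrite formE normE mulr_suml; apply: ler_sum => k _.
  by rewrite mulrC ler_wpM2l ?sqr_ge0 // lef_pV2 ?posrE.
Qed.
End inverse_form.

(** * The bounds *)

Local Close Scope classical_set_scope.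

Theorem corollary5p24 (R : realType) (N : nat) (G : sgraph N) (S : {set 'I_N})
    (hS : (1 <= #|S|)%N) (hconn : pseudo_connected G S)
    (lambda_min : R)
    (hmin : smallest_eigenvalue (loop_laplacian R G S) lambda_min) :
  ((- (1 / lambda_min))%:E < eq_heat_integral R G S < 0)%E.
Proof.
have Lpos (x : 'rV[R]_N) := loop_laplacian_posdef (x := x) hconn.
have N_gt0 : (0 < N)%N.
  by rewrite -(card_ord N); apply: leq_trans hS (max_card _).
have one_n0 : const_mx 1 != 0 :> 'rV[R]_N.
  by apply/eqP => /rowP/(_ (Ordinal N_gt0))/eqP; rewrite !mxE oner_eq0.
have [Li [LiL Lisym lam_gt0 q_gt0]] :=
  posdef_inverse_form (loop_laplacian_sym R G S) Lpos hmin one_n0.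
have -> : dotr (const_mx 1) (const_mx 1 : 'rV[R]_N) = N%:R.
  rewrite dotrE -[in RHS](card_ord N) -sumr_const.
  by apply: eq_bigr => i _; rewrite !mxE mulr1.
rewrite (heat_integral_lift LiL Lisym); set q := dotr _ _ in q_gt0 *.
move=> q_le; set n := (N + (1 + N))%:R.
have n_gt0 : 0 < n :> R by rewrite ltr0n addnCA.
have nE : n = 2 * N%:R + 1 :> R by rewrite /n !natrD; ring.
rewrite !lte_fin oppr_lt0 ltrN2 mulr_gt0 ?divr_gt0 // andbT.
rewrite mulrAC ltr_pdivrMr // mulrAC ltr_pdivlMr //.
move: q_le; rewrite ler_pdivlMr // => q_le; rewrite nE.
rewrite (le_lt_trans (_ : _ <= 2 * N%:R)) //; last by lra.
by rewrite -mulrA ler_wpM2l.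
Qed.
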